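(* For $\lambda\in I$ and every $z\in\mathbb R$, the Evans function $D$ is given by $$D(\lambda)=-e^{2cz}\det\begin{bmatrix}\omega(u_1,u_3)&\omega(u_1,u_4)\\ \omega(u_2,u_3)&\omega(u_2,u_4)\end{bmatrix},$$ where $u_i=u_i(\lambda,z)$ and $D$, $\omega$, $u_i$, $I$ are as in the context.
   Context: Setting. Let $f,g\in C^2(\mathbb R)$ and $\alpha,\sigma>0$, and consider $u_t=u_{xx}+f(u)-\sigma v$, $v_t=v_{xx}+g(v)+\alpha u$. Here $(0,0)$ is an equilibrium with $f'(0)+g'(0)<0$ and $f'(0)g'(0)+\sigma\alpha>0$. The system has a traveling wave $\varphi=(\hat u,\hat v)$ of speed $c$, a nonconstant solution depending only on $z=x-ct$ and decaying exponentially to $(0,0)$ as $z\to\pm\infty$. Thus, also writing $\varphi=(\hat u,\hat v,\hat u'/\sigma,\hat v'/\alpha)$, $\varphi$ is an orbit homoclinic to $0\in\mathbb R^4$ of the system (TW): $u'=\sigma w$, $v'=\alpha y$, $w'=-cw-f(u)/\sigma+v$, $y'=-cy-u-g(v)/\alpha$. Let $\nu_1,\nu_2$ be the eigenvalues of $\begin{pmatrix}f'(0)&-\sigma\\ \alpha&g'(0)\end{pmatrix}$. Standing assumptions: (A1) $c<0$. (A2) $\nu_1,\nu_2$ are real and simple, with $\nu_1<\nu_2<0$. For real $\lambda>\nu_2$ set $\mu_{1}(\lambda)=-\frac c2-\frac12\sqrt{c^2+4(\lambda-\nu_1)}$, $\mu_{2}(\lambda)=-\frac c2-\frac12\sqrt{c^2+4(\lambda-\nu_2)}$,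 $\mu_{3}(\lambda)=-\frac c2+\frac12\sqrt{c^2+4(\lambda-\nu_2)}$, $\mu_{4}(\lambda)=-\frac c2+\frac12\sqrt{c^2+4(\lambda-\nu_1)}$. (A3) The exponential decay rate of $\varphi$ is exactly $\mu_2(0)$ as $z\to+\infty$ and exactly $\mu_3(0)$ as $z\to-\infty$. (A4) $\varphi$ is transversely constructed: for (TW) augmented with $c'=0$ (in $\mathbb R^5$), the curve $(\varphi(z),c)$ is given by the transverse intersection of the center-unstable and center-stable manifolds of the fixed point $(0,0,0,0,c)$. Linearized system. For $\lambda\in\mathbb R$ consider $Y'=A(\lambda,z)Y$ on $\mathbb R^4$ with $$A(\lambda,z)=\begin{pmatrix}0&0&\sigma&0\\0&0&0&\alpha\\ \frac{\lambda-f'(\hat u(z))}{\sigma}&1&-c&0\\-1&\frac{\lambda-g'(\hat v(z))}{\alpha}&0&-c\end{pmatrix},\qquad A_\infty(\lambda)=\lim_{z\to\pm\infty}A(\lambda,z).$$ The eigenvalues of $A_\infty(\lambda)$ are $\mu_1(\lambda),\dots,\mu_4(\lambda)$. Fix $\delta>0$ small so that on $I=[-\delta,\infty)$ these are real and simple with $\mu_1<\mu_2<0<\mu_3<\mu_4$. For $\lambda\in I$, $u_i(\lambda,z)$ are solutions of $Y'=A(\lambda,z)Y$, analytic in $\lambda$, with $\lim_{z\to+\infty}e^{-\mu_i(\lambda)z}u_i(\lambda,z)=\eta_i(\lambda)$ for $i=1,2$ and $\lim_{z\to-\infty}e^{-\mu_i(\lambda)z}u_i(\lambda,z)=\eta_i(\lambda)$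 for $i=3,4$, uniformly on compact subsets of $I$, where $\eta_i(\lambda)$ is a nonzero eigenvector of $A_\infty(\lambda)$ for $\mu_i(\lambda)$. Normalization: $u_2(0,z)=u_3(0,z)=\varphi'(z)=(\hat u',\hat v',\hat u''/\sigma,\hat v''/\alpha)$ and $\det[\eta_1(0),\eta_2(0),\eta_3(0),\eta_4(0)]=\rho>0$. Evans function: for $\lambda\in I$, $D(\lambda)\,e_1\wedge e_2\wedge e_3\wedge e_4=e^{2cz}\,u_1(\lambda,z)\wedge u_2(\lambda,z)\wedge u_3(\lambda,z)\wedge u_4(\lambda,z)$, which is independent of $z$. Symplectic form on $\mathbb R^4$: $\omega(a,b)=(a_1b_3-a_3b_1)-(a_2b_4-a_4b_2)$. *)

(* Defs.v *)
(* R^n is the normed space ['cV[R]_n]; coordinates and the lists below are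
   numbered from 0. *)
From HB Require Import structures.
From mathcomp Require Import all_boot all_order all_algebra.
From mathcomp Require Import all_classical all_reals all_analysis.

Set Implicit Arguments.
Unset Strict Implicit.
Unset Printing Implicit Defensive.

Import Order.TTheory GRing.Theory Num.Theory.
Import numFieldNormedType.Exports.

Local Open Scope classical_set_scope.
Local Open Scope ring_scope.

Section Vectors.
Variable R : realType.

Definition colv n (s : seq R) : 'cV[R]_n := \col_(i < n) s`_i.

Definition mat m n (s : seq (seq R)) : 'M[R]_(m, n) :=
  \matrix_(i < m, j < n) (nth [::] s i)`_j.

Definition mat_of_cols n (s : seq 'cV[R]_n) : 'M[R]_n :=
  \matrix_(i < n, j < n) (nth 0 s j) i 0.

Definition omega (a b : 'cV[R]_4) : R :=
  (a 0 0 * b 2 0 - a 2 0 * b 0 0) - (a 1 0 * b 3 0 - a 3 0 * b 1 0).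

End Vectors.

Section Analysis.
Variable R : realType.

Definition class_C (k : nat) (f : R -> R) : Prop :=
  (forall n, (n < k)%N -> forall x, derivable (derive1n n f) x 1) /\
  continuous (derive1n k f).

(* Real analyticity on a set, possibly with boundary points: near each of its
   points the function is the sum, on the set, of a power series. *)
Definition analytic_on (V : normedModType R) (I : set R) (F : R -> V) : Prop :=
  forall l0, I l0 -> exists2 r : R, 0 < r & exists a : nat -> V,
    forall l, I l -> `|l - l0| < r ->
      series (fun n => (l - l0) ^+ n *: a n) @ \oo --> F l.

End Analysis.

Section PDE.
Variable R : realType.
Variables (f g : R -> R) (alpha sigma : R).

(* U and V take the space variable first, then time. *)
Definition solves_pde (U V : R -> R -> R) : Prop :=
  forall x t : R,
  [/\ derivable (U x) t 1, derivable (V x) t 1,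
      (forall y, derivable (U^~ t) y 1 /\ derivable (V^~ t) y 1) &
      derivable (derive1 (U^~ t)) x 1 /\ derivable (derive1 (V^~ t)) x 1] /\
  derive1 (U x) t = derive1n 2 (U^~ t) x + f (U x t) - sigma * V x t /\
  derive1 (V x) t = derive1n 2 (V^~ t) x + g (V x t) + alpha * U x t.

Definition traveling_wave (c : R) (uh vh : R -> R) : Prop :=
  [/\ solves_pde (fun x t => uh (x - c * t)) (fun x t => vh (x - c * t)),
      ~ (exists k l : R, forall z, uh z = k /\ vh z = l) &
      exists K kappa : R, 0 < kappa /\
        forall z, `|uh z| <= K * expR (- kappa * `|z|) /\
                  `|vh z| <= K * expR (- kappa * `|z|)].

Definition phi (uh vh : R -> R) (z : R) : 'cV[R]_4 :=
  colv 4 [:: uh z; vh z; derive1 uh z / sigma; derive1 vh z / alpha].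

Definition phi_ext (c : R) (uh vh : R -> R) (z : R) : 'cV[R]_5 :=
  colv 5 [:: uh z; vh z; derive1 uh z / sigma; derive1 vh z / alpha; c].

(* The first-order traveling wave system augmented with c' = 0; the unknowns
   are (u, v, w, y, c), where w = u' / sigma and y = v' / alpha. *)
Definition tw_field (x : 'cV[R]_5) : 'cV[R]_5 :=
  let: u := x 0 0 in let: v := x 1 0 in let: w := x 2 0 in
  let: y := x 3 0 in let: c := x 4 0 in
  colv 5 [:: sigma * w;
             alpha * y;
             - c * w - f u / sigma + v;
             - c * y - u - g v / alpha;
             0].

Definition rest_point (c : R) : 'cV[R]_5 := colv 5 [:: 0; 0; 0; 0; c].

Definition reaction_mx : 'M[R]_2 :=
  mat 2 2 [:: [:: derive1 f 0; - sigma];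
              [:: alpha;   derive1 g 0]].

Definition linearized_mx (c : R) (uh vh : R -> R) (lambda z : R) : 'M[R]_4 :=
  mat 4 4
    [:: [:: 0; 0; sigma; 0];
        [:: 0; 0; 0; alpha];
        [:: (lambda - derive1 f (uh z)) / sigma; 1; - c; 0];
        [:: -1; (lambda - derive1 g (vh z)) / alpha; 0; - c]].

End PDE.

Section InvariantManifolds.
Variable R : realType.
Variable n' : nat.
Local Notation E := 'cV[R]_n'.+1.

Definition solution_on (F : E -> E) (a b : R) (X : R -> E) : Prop :=
  forall t, a <= t <= b -> is_derive t 1 X (F (X t)).

Definition flows_to (F : E -> E) (T : R) (x y : E) : Prop :=
  exists X : R -> E, [/\ solution_on F 0 T X, X 0 = x & X T = y].

(* The sum of the generalized eigenspaces of L for the real eigenvalues that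
   satisfy P.  This is used for operators whose spectrum is real. *)
Definition gen_eigenvector (L : E -> E) (a : R) (w : E) : Prop :=
  exists k, iter k (fun v => L v - a *: v) w = 0.

Definition spectral_space (L : E -> E) (P : R -> bool) : set E :=
  [set v | exists m (a : 'I_m -> R) (w : 'I_m -> E),
     (forall i, P (a i) /\ gen_eigenvector L (a i) (w i)) /\
     v = \sum_i w i].

(* Embedded C^1 submanifolds, as local regular level sets. *)
Definition submanifold (q : nat) (W : set E) : Prop :=
  forall p, W p -> exists (U : set E) (h : E -> 'cV[R]_q.+1),
    [/\ open U, U p,
        (forall x, U x -> differentiable h x /\
           forall v, {for x, continuous (fun x' => 'd h x' v)}),
        (forall x, U x -> forall y, exists v, 'd h x v = y) &
        W `&` U = [set x | U x /\ h x = 0]].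

Definition tangent_space (W : set E) (p : E) : set E :=
  [set v | exists gamma : R -> E,
     [/\ gamma 0 = p, (\forall s \near (0 : R), W (gamma s)) &
         is_derive (0 : R) 1 gamma v]].

Definition locally_invariant (F : E -> E) (U W : set E) : Prop :=
  forall (a b : R) (X : R -> E), solution_on F a b X ->
    (forall t, a <= t <= b -> U (X t)) ->
    forall s t, a <= s <= b -> a <= t <= b -> W (X s) -> W (X t).

Definition local_spectral_manifold (P : R -> bool) (F : E -> E) (p : E)
    (W : set E) : Prop :=
  F p = 0 /\ W p /\
  (exists U : set E, [/\ open U, U p, W `<=` U & locally_invariant F U W]) /\
  (exists q, submanifold q W) /\
  tangent_space W p = spectral_space ('d F p) P.

Definition local_center_stable := local_spectral_manifold (fun a => a <= 0).
Definition local_center_unstable := local_spectral_manifold (fun a => 0 <= a).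

(* The images of W under the flow for time -T, resp. T; the global
   center-stable and center-unstable manifolds are the unions of these sets
   over T >= 0, W being a local manifold. *)
Definition backward_image (F : E -> E) (T : R) (W : set E) : set E :=
  [set x | exists2 y, W y & flows_to F T x y].
Definition forward_image (F : E -> E) (T : R) (W : set E) : set E :=
  [set x | exists2 y, W y & flows_to F T y x].

(* The orbit Phi is in the intersection of the center-unstable and the
   center-stable manifolds of p, which is transverse at each of its points.
   At Phi z the tangent spaces are those of the flowed-out local manifolds;
   requiring the tails of Phi to remain in the local manifolds picks the
   sheets of the (only immersed) global manifolds that contain Phi. *)
Definition transversely_constructed (F : E -> E) (p : E) (Phi : R -> E)
    : Prop :=
  exists Wcu Wcs : set E,
    [/\ local_center_unstable F p Wcu, local_center_stable F p Wcs &
    forall z, exists2 T : R, 0 <= T &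
      [/\ (forall t, T <= t -> Wcu (Phi (z - t)) /\ Wcs (Phi (z + t))),
          forward_image F T Wcu (Phi z),
          backward_image F T Wcs (Phi z) &
          forall v, exists a b,
            [/\ tangent_space (forward_image F T Wcu) (Phi z) a,
                tangent_space (backward_image F T Wcs) (Phi z) b &
                v = a + b]]].

End InvariantManifolds.

Section EvansFunction.
Variable R : realType.

(* For a function tending to 0, the limit is its exponential decay rate,
   with the sign of the exponent, at +oo or at -oo according to G. *)
Definition exp_rate (V : normedModType R) (G : set_system R) (F : R -> V)
    (r : R) : Prop :=
  (fun z => ln `|F z| / z) @ G --> r.

Definition mu_minus (c nu lambda : R) : R :=
  - (c / 2) - Num.sqrt (c ^+ 2 + 4 * (lambda - nu)) / 2.
Definition mu_plus (c nu lambda : R) : R :=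
  - (c / 2) + Num.sqrt (c ^+ 2 + 4 * (lambda - nu)) / 2.

(* G is the filter of neighborhoods of +oo or of -oo. *)
Definition basis_solution (I : set R) (A : R -> R -> 'M[R]_4)
    (Ainf : R -> 'M[R]_4) (G : set_system R) (mu : R -> R)
    (eta : R -> 'cV[R]_4) (u : R -> R -> 'cV[R]_4) : Prop :=
  [/\ (forall lambda, I lambda -> forall z : R,
         is_derive z 1 (u lambda) (A lambda z *m u lambda z)),
      (forall z, analytic_on I (u^~ z)),
      (forall lambda, I lambda ->
         eta lambda != 0 /\
         Ainf lambda *m eta lambda = mu lambda *: eta lambda) &
      (forall K : set R, compact K -> K `<=` I ->
         {uniform K, (fun z lambda => expR (- mu lambda * z) *: u lambda z) @ G
                     --> eta})].

(* In the line of 4-vectors of R^4, the exterior product of a, b, c, d is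
   det[a, b, c, d] times that of the standard basis.  The Evans function is thus the
   number that satisfies its defining equation at every z (and [get] returns a
   default value if there is none). *)
Definition evans (c : R) (u1 u2 u3 u4 : R -> R -> 'cV[R]_4) (lambda : R) : R :=
  get [set d : R | forall z : R, d = expR (2 * c * z) *
    \det (mat_of_cols [:: u1 lambda z; u2 lambda z; u3 lambda z; u4 lambda z])].

End EvansFunction.

(* Main.v *)
(* The volume form of R^4 is half the square of omega, so that
   det[u1, u2, u3, u4] = w12 w34 - w13 w24 + w14 w23 where wij = omega(ui, uj).
   The linearized system is a symplectic one up to the damping -c: along any two
   solutions e^{cz} omega is constant.  Hence e^{2cz} det[u1, u2, u3, u4] does not
   depend on z.  For u1 and u2 this constant is 0, since e^{cz} w12 behaves as
   e^{(c + mu1 + mu2) z} with c, mu1, mu2 < 0 when z tends to +oo; thus w12 = 0. *)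
Require Import Defs.
From HB Require Import structures.
From mathcomp Require Import all_boot all_order all_algebra.
From mathcomp Require Import all_classical all_reals all_analysis.
From mathcomp Require Import ring lra.

Import Order.TTheory GRing.Theory Num.Theory.
Import numFieldNormedType.Exports.

Local Open Scope classical_set_scope.
Local Open Scope ring_scope.

Section Symplectic.
Variable R : realType.
Implicit Types (a b c d : 'cV[R]_4) (Y Z : R -> 'cV[R]_4).

(** The right-hand side is the Pfaffian of the matrix of the pairings of [a], [b], [c], [d]. The
    identity is polynomial in the sixteen coordinates and is checked by full expansion. *)
Lemma det_mat_of_cols a b c d :
  \det (mat_of_cols [:: a; b; c; d]) =
  omega a b * omega c d - omega a c * omega b d + omega a d * omega b c.
Proof.
(* Row expansion produces indices as iterated [lift]s; the numerals in [omega] must take the same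
   form for [ring] to identify the entries. *)
have o1 : (1 : 'I_4) = lift ord0 ord0 by apply/val_inj.
have o2 : (2 : 'I_4) = lift ord0 (lift ord0 ord0) by apply/val_inj.
have o3 : (3 : 'I_4) = lift ord0 (lift ord0 (lift ord0 ord0)) by apply/val_inj.
rewrite /omega o3 o2 o1.
do ?rewrite (expand_det_row _ ord0) !big_ord_recl big_ord0 /cofactor.
rewrite !det_mx00 !mxE /=; ring.
Qed.

Lemma det_mat22 (x y z t : R) :
  \det (mat 2 2 [:: [:: x; y]; [:: z; t]]) = x * t - y * z.
Proof.
do ?rewrite (expand_det_row _ ord0) !big_ord_recl big_ord0 /cofactor.
rewrite !det_mx00 !mxE /=; ring.
Qed.

Lemma omegaZZ (k l : R) a b : omega (k *: a) (l *: b) = k * l * omega a b.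
Proof. rewrite /omega !mxE; ring. Qed.

(** Without damping the matrix is infinitesimally symplectic: the minus sign in [omega] compensates
    for the opposite signs of the coupling entries 1 and -1. Each term of [omega] has exactly one
    factor among the two damped coordinates, hence a single [- s]. *)
Lemma omega_linearized f g alpha sigma s uh vh lambda z a b :
  alpha != 0 -> sigma != 0 ->
  let A := linearized_mx f g alpha sigma s uh vh lambda z in
  omega (A *m a) b + omega a (A *m b) = - s * omega a b.
Proof.
move=> alpha0 sigma0 A.
have o1 : (1 : 'I_4) = lift ord0 ord0 by apply/val_inj.
have o2 : (2 : 'I_4) = lift ord0 (lift ord0 ord0) by apply/val_inj.
have o3 : (3 : 'I_4) = lift ord0 (lift ord0 (lift ord0 ord0)) by apply/val_inj.
rewrite /omega o3 o2 o1 !mxE !big_ord_recl !big_ord0 !mxE /=.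
by field; rewrite alpha0 sigma0.
Qed.

Lemma is_derive_coord n (M : R -> 'cV[R]_n) M' (t : R) i :
  is_derive t 1 M M' -> is_derive t 1 (fun x => M x i 0) (M' i 0).
Proof.
move=> [dM <-]; rewrite derive_mx // mxE; apply: DeriveDef => //.
by move/derivable_mxP: dM.
Qed.

Lemma is_derive_omega Y Z a b (t : R) :
  is_derive t 1 Y a -> is_derive t 1 Z b ->
  is_derive t 1 (fun x => omega (Y x) (Z x))
    (omega a (Z t) + omega (Y t) b).
Proof.
move=> dY dZ.
have dYi i := is_derive_coord _ _ _ _ i dY.
have dZi i := is_derive_coord _ _ _ _ i dZ.
rewrite /omega.
apply: is_derive_eq.
by rewrite /GRing.scale /=; ring.
Qed.

Lemma cvg_omega Y Z a b (F : set_system R) : Filter F ->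
  Y x @[x --> F] --> a -> Z x @[x --> F] --> b ->
  omega (Y x) (Z x) @[x --> F] --> omega a b.
Proof.
move=> FF Ya Zb.
have cY i : Y x i 0 @[x --> F] --> a i 0.
  exact: (cvg_comp _ _ Ya (@coord_continuous _ _ _ i 0 a)).
have cZ i : Z x i 0 @[x --> F] --> b i 0.
  exact: (cvg_comp _ _ Zb (@coord_continuous _ _ _ i 0 b)).
by rewrite /omega; do !apply: cvgB; apply: cvgM.
Qed.

Lemma cvg_expR_lt0 (k : R) : k < 0 -> expR (k * z) @[z --> +oo] --> 0.
Proof.
move=> k0.
have kz : - k * z @[z --> +oo] --> +oo by apply: gt0_cvgMry; rewrite ?oppr_gt0.
apply: cvg_trans (cvg_comp _ _ kz (@cvgr_expR R)).
by apply: near_eq_cvg; near=> z; rewrite /= mulNr opprK.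
Unshelve. all: by end_near. Qed.

Section Linearized.
Context (f g : R -> R) (alpha sigma c : R) (uh vh : R -> R) (lambda : R).
Hypotheses (alpha0 : alpha != 0) (sigma0 : sigma != 0).
Let A := linearized_mx f g alpha sigma c uh vh lambda.

(** By the product rule, the rate [c] of the exponential cancels the rate [- c] given by
    [omega_linearized]. *)
Lemma expR_omega_cst Y Z :
  (forall z : R, is_derive z 1 Y (A z *m Y z)) ->
  (forall z : R, is_derive z 1 Z (A z *m Z z)) ->
  forall s t : R, expR (c * s) * omega (Y s) (Z s) =
                  expR (c * t) * omega (Y t) (Z t).
Proof.
move=> dY dZ s t.
apply: (@is_derive_0_is_cst R (fun z => expR (c * z) * omega (Y z) (Z z))).
move=> z; have dO := is_derive_omega _ _ _ _ _ (dY z) (dZ z).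
rewrite omega_linearized // in dO.
have dE : is_derive z 1 (fun x => expR (c * x)) (c * expR (c * z)).
  apply: is_derive_eq; rewrite /GRing.scale /=; ring.
apply: is_derive_eq; rewrite /GRing.scale /=; ring.
Qed.

Lemma omega_decaying_eq0 Y Z (m1 m2 : R) a b :
  (forall z : R, is_derive z 1 Y (A z *m Y z)) ->
  (forall z : R, is_derive z 1 Z (A z *m Z z)) ->
  expR (- m1 * z) *: Y z @[z --> +oo] --> a ->
  expR (- m2 * z) *: Z z @[z --> +oo] --> b ->
  c + m1 + m2 < 0 ->
  forall z, omega (Y z) (Z z) = 0.
Proof.
move=> dY dZ Ya Zb lt0 t.
(* This is the constant of [expR_omega_cst] with both solutions rescaled to have limits: the pairing
   stays bounded near +oo and the remaining exponential tends to 0. *)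
pose F z := expR ((c + m1 + m2) * z) *
  omega (expR (- m1 * z) *: Y z) (expR (- m2 * z) *: Z z).
have F0 : F z @[z --> +oo] --> 0 * omega a b.
  by apply: cvgM; [exact: cvg_expR_lt0|exact: cvg_omega].
have FE : F = cst (expR (c * t) * omega (Y t) (Z t)).
  apply/funext => z; rewrite /F /= omegaZZ (expR_omega_cst _ _ dY dZ t z) mulrA.
  congr (_ * _); rewrite -!expRD; congr expR; ring.
rewrite FE mul0r in F0.
have := cvg_lim (@Rhausdorff R) F0.
rewrite lim_cst; last exact: Rhausdorff.
move/(_ proper_pinfty_nbhs)/eqP; by rewrite mulf_eq0 gt_eqF ?expR_gt0 //= => /eqP.
Qed.

End Linearized.
End Symplectic.

Theorem corollary1 (R : realType) (f g : R -> R) (alpha sigma c : R)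
    (uh vh : R -> R) (nu1 nu2 delta rho : R)
    (Ainf : R -> 'M[R]_4)
    (eta1 eta2 eta3 eta4 : R -> 'cV[R]_4)
    (u1 u2 u3 u4 : R -> R -> 'cV[R]_4) :
  let I : set R := `[- delta, +oo[%classic in
  let mu1 := mu_minus c nu1 in
  let mu2 := mu_minus c nu2 in
  let mu3 := mu_plus c nu2 in
  let mu4 := mu_plus c nu1 in
  let A := linearized_mx f g alpha sigma c uh vh in
  let phi := phi alpha sigma uh vh in
  let D := evans c u1 u2 u3 u4 in
  (* the reaction-diffusion system and the wave *)
  class_C 2 f -> class_C 2 g -> 0 < alpha -> 0 < sigma ->
  f 0 = 0 -> g 0 = 0 ->
  derive1 f 0 + derive1 g 0 < 0 ->
  0 < derive1 f 0 * derive1 g 0 + sigma * alpha ->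
  traveling_wave f g alpha sigma c uh vh ->
  (* (A1) *)
  c < 0 ->
  (* (A2) *)
  char_poly (reaction_mx f g alpha sigma) = ('X - nu1%:P) * ('X - nu2%:P) ->
  nu1 < nu2 -> nu2 < 0 ->
  (* (A3) *)
  exp_rate +oo phi (mu2 0) -> exp_rate -oo phi (mu3 0) ->
  (* (A4) *)
  transversely_constructed (tw_field f g alpha sigma) (rest_point c)
    (phi_ext alpha sigma c uh vh) ->
  (* the linearized system *)
  (forall lambda, A lambda z @[z --> +oo] --> Ainf lambda) ->
  (forall lambda, A lambda z @[z --> -oo] --> Ainf lambda) ->
  0 < delta -> nu2 < - delta ->
  (forall lambda, I lambda ->
     [/\ mu1 lambda < mu2 lambda, mu2 lambda < 0,
         0 < mu3 lambda & mu3 lambda < mu4 lambda]) ->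
  basis_solution I A Ainf +oo mu1 eta1 u1 ->
  basis_solution I A Ainf +oo mu2 eta2 u2 ->
  basis_solution I A Ainf -oo mu3 eta3 u3 ->
  basis_solution I A Ainf -oo mu4 eta4 u4 ->
  (forall z, u2 0 z = derive1 phi z) -> (forall z, u3 0 z = derive1 phi z) ->
  \det (mat_of_cols [:: eta1 0; eta2 0; eta3 0; eta4 0]) = rho -> 0 < rho ->
  forall lambda, I lambda -> forall z : R,
    D lambda = - expR (2 * c * z) *
      \det (mat 2 2
        [:: [:: omega (u1 lambda z) (u3 lambda z);
                omega (u1 lambda z) (u4 lambda z)];
            [:: omega (u2 lambda z) (u3 lambda z);
                omega (u2 lambda z) (u4 lambda z)]]).
Proof.
move=> I mu1 mu2 mu3 mu4 A phi D _ _ alpha_gt0 sigma_gt0 _ _ _ _ _ c_lt0.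
move=> _ _ _ _ _ _ _ _ _ _ ltmu B1 B2 B3 B4 _ _ _ _ lambda Ilambda z.
have alpha0 : alpha != 0 by rewrite gt_eqF.
have sigma0 : sigma != 0 by rewrite gt_eqF.
have [lt12 lt20 _ _] := ltmu _ Ilambda.
(* On a compact singleton, uniform convergence is convergence at [lambda]. *)
have K1 : [set lambda] `<=` I by move=> _ ->.
have [d1 _ _ /(_ _ (@compact_set1 _ lambda) K1)] := B1.
have [d2 _ _ /(_ _ (@compact_set1 _ lambda) K1)] := B2.
rewrite !uniform_set1 => u2_eta2 u1_eta1.
have [d3 _ _ _] := B3; have [d4 _ _ _] := B4.
have o12 s : omega (u1 lambda s) (u2 lambda s) = 0.
  apply: (omega_decaying_eq0 _ f g alpha sigma c uh vh lambda alpha0 sigma0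
    _ _ (mu1 lambda) (mu2 lambda) _ _ (d1 _ Ilambda) (d2 _ Ilambda)
    u1_eta1 u2_eta2).
  lra.
have cst Y Z dY dZ := expR_omega_cst _ f g alpha sigma c uh vh lambda
  alpha0 sigma0 Y Z dY dZ.
have E2 s : expR (2 * c * s) = expR (c * s) * expR (c * s).
  by rewrite -expRD; congr expR; ring.
(* Splitting [expR (2 * c * s)] evenly gives every pairing its own [expR (c * s)], so that each of
   the four factors is constant. *)
pose W s := expR (c * s) * omega (u1 lambda s) (u4 lambda s) *
   (expR (c * s) * omega (u2 lambda s) (u3 lambda s)) -
   expR (c * s) * omega (u1 lambda s) (u3 lambda s) *
   (expR (c * s) * omega (u2 lambda s) (u4 lambda s)).
have detW s : expR (2 * c * s) *
    \det (mat_of_cols [:: u1 lambda s; u2 lambda s; u3 lambda s; u4 lambda s])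
    = W s.
  rewrite det_mat_of_cols o12 E2 /W; ring.
have Wz s : W z = W s.
  rewrite /W (cst _ _ (d1 _ Ilambda) (d4 _ Ilambda) z s).
  rewrite (cst _ _ (d2 _ Ilambda) (d3 _ Ilambda) z s).
  rewrite (cst _ _ (d1 _ Ilambda) (d3 _ Ilambda) z s).
  by rewrite (cst _ _ (d2 _ Ilambda) (d4 _ Ilambda) z s).
rewrite det_mat22 E2; transitivity (W z); last by rewrite /W; ring.
(* [W z] satisfies the defining equation of [evans] at every point, by [Wz], and any other solution
   agrees with it on evaluation at [z]; so [get] does not fall back on its default. *)
apply: get_unique => [s|y /(_ z)]; rewrite detW //.
Qed.
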